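(* There exists exactly one Markov transition kernel $\mu$ on $[0,\infty)$ with $\mu(0,\{0\})=1$ and $\mu(t,[0,t))=1$ for every $t>0$ (absorbing state $0$ and strictly decreasing paths) such that, for every $t>0$, the chain $(X_n)_{n\ge0}$ with $X_0=t$ satisfies $$P\big(\#\{n\ge1: X_n\in(0,t)\}=j\big)=q_j(t)\qquad\text{for all } j\ge0.$$
   Context: $\sigma_1(k,j)$ are the unsigned Stirling numbers of the first kind ($\sigma_1(k,j)=0$ for $k<j$, $\sigma_1(0,0)=1$); $p_j(t)=e^{-t}\sum_{k=j}^\infty \frac{t^k}{k!}\frac{\sigma_1(k,j)}{k!}$; and $q_j(t)=\frac1t\int_0^t p_j(u)\,du$ for $t>0$, equivalently $q_j(t)=e^{-t}\sum_{k=0}^\infty\frac{t^k}{(k+1)!}\sum_{i=0}^k\frac{\sigma_1(i,j)}{i!}$ (a probability distribution in $j\ge0$). *)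

(* Defs.v *)
From HB Require Import structures.
From mathcomp Require Import all_boot all_order all_algebra.
From mathcomp Require Import all_classical all_reals all_analysis.
From mathcomp Require Import measurable_realfun.
Set Implicit Arguments. Unset Strict Implicit. Unset Printing Implicit Defensive.
Import Order.TTheory GRing.Theory Num.Theory.
Import numFieldNormedType.Exports.
Local Open Scope classical_set_scope.
Local Open Scope ring_scope.

Fixpoint stirling1 (n k : nat) {struct n} : nat :=
  match n, k with
  | 0, 0 => 1
  | 0, _.+1 => 0
  | _.+1, 0 => 0
  | n'.+1, k'.+1 => n' * stirling1 n' k + stirling1 n' k'
  end.

Section Defs.
Variable R : realType.

Definition p_ (j : nat) (t : R) : R :=
  expR (- t) *
  limn (fun n => \sum_(j <= k < n)
          (t ^+ k / (k`!)%:R * (stirling1 k j)%:R / (k`!)%:R)).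

Definition q_ (j : nat) (t : R) : R :=
  t^-1 * (\int[lebesgue_measure]_(u in `[0, t]%classic) p_ j u).

(* A Markov transition kernel on the state space [0, +oo): to every state
   t >= 0 a probability measure mu t on (the Borel sets of) R, carried by
   [0,+oo) (this support condition follows from the hypotheses of the theorem),
   and t |-> mu t A measurable on [0,+oo) for every measurable A. *)
Definition markov_kernel0 (mu : R -> probability R R) : Prop :=
  forall A : set R, measurable A ->
    measurable_fun [set t : R | 0 <= t] (fun t : R => (mu t A : \bar R)).

(* Expectation E_s[f(X_1,...,X_N)] for the Markov chain with kernel mu started
   at X_0 = s: the standard (Ionescu-Tulcea) finite-dimensional law,
   given by iterated kernel integrals. *)
Fixpoint pathE (mu : R -> probability R R) (N : nat)
    (f : seq R -> \bar R) (s : R) {struct N} : \bar R :=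
  match N with
  | 0 => f [::]
  | N'.+1 => (\int[mu s]_y pathE mu N' (fun xs => f (y :: xs)) y)%E
  end.

Definition cnt_in (t : R) (xs : seq R) : nat :=
  count (fun x => (0 < x) && (x < t)) xs.

Definition P_le_N (mu : R -> probability R R) (t : R) (N j : nat) : \bar R :=
  pathE mu N (fun xs => ((cnt_in t xs <= j)%N)%:R%:E) t.

(* P_t( #{n >= 1 : X_n in (0,t)} <= j ): the events
   {#{1<=n<=N : X_n in (0,t)} <= j} decrease in N to this event, so its
   probability is the limit (continuity of the path measure). *)
Definition P_le (mu : R -> probability R R) (t : R) (j : nat) : \bar R :=
  limn (fun N => P_le_N mu t N j).

Definition P_eq (mu : R -> probability R R) (t : R) (j : nat) : \bar R :=
  match j with
  | 0 => P_le mu t 0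
  | j'.+1 => (P_le mu t j - P_le mu t j')%E
  end.

Definition thm3_property (mu : R -> probability R R) : Prop :=
  [/\ markov_kernel0 mu,
      mu 0 [set 0] = 1%E,
      (forall t : R, 0 < t -> mu t `[0, t[%classic = 1%E) &
      (forall t : R, 0 < t -> forall j : nat, P_eq mu t j = (q_ j t)%:E)].

End Defs.

(* Main.v *)
Require Import Defs.
From HB Require Import structures.
From mathcomp Require Import all_boot all_order all_algebra.
From mathcomp Require Import all_classical all_reals all_analysis.
From mathcomp Require Import measurable_realfun.
From mathcomp Require Import lra ring.
Import Order.TTheory GRing.Theory Num.Theory.
Set Implicit Arguments. Unset Strict Implicit. Unset Printing Implicit Defensive.
Import numFieldNormedType.Exports.
Local Open Scope classical_set_scope.
Local Open Scope ring_scope.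

(** Write E_j(t) = sum_k s(k,j) t^k / (k!)^2, so that p_j = e^{-t} E_j. The
    Stirling recurrence says t E'' + E' - t E' = E_j for E = E_{j+1}; hence
    q_j = e^{-t} E_{j+1}' and p_{j+1}' + p_{j+1} = q_j. Since paths decrease
    strictly to 0, the first N > j steps decide whether the count is at most
    j, and the requirement on mu becomes mu(t,{0}) = q_0(t) together with
    int_(0,t) q_j(y) mu(t,dy) = q_{j+1}(t) for all j and t > 0.

    Existence: let mu(t,.) be the law of max(tU - X, 0), with U uniform and X
    exponential. It has density (1 - e^{x-t})/t on (0,t), and the integral
    equations follow from the differential ones by the fundamental theorem of
    calculus.

    Uniqueness: for m >= 0, sum_j (m+1)^j q_j(y) is by Vandermonde's identity
    the polynomial sum_n C(m,n) y^n/(n+1)! of degree m, so the equations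
    determine all moments of mu(t,.), which lives on a bounded interval. *)

(** * Power series *)

Section power_series.
Variable R : realType.
Implicit Types (c : R^nat) (x : R).

(** Domination by the exponential series: such power series converge on the whole line, and the
    class is stable under termwise differentiation. *)
Definition fact_bounded c := forall k, 0 <= c k <= (k`!%:R)^-1.

Definition psum c x : R := limn (pseries c x).

Lemma fact_bounded_diffs c : fact_bounded c -> fact_bounded (pseries_diffs c).
Proof.
move=> cb k; have /andP[c0 cle] := cb k.+1.
rewrite /pseries_diffs mulr_ge0//= (le_trans (ler_wpM2l _ cle))//.
by rewrite factS natrM invfM mulrA divff ?mul1r// pnatr_eq0.
Qed.

Lemma fact_bounded_cvg c x : fact_bounded c -> cvgn (pseries c x).
Proof.
move=> cb; apply: normed_cvg.
apply: (series_le_cvg _ _ _ (is_cvg_series_exp_coeff `|x|)) => k.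
- exact: normr_ge0.
- by rewrite /exp_coeff /= mulr_ge0// exprn_ge0.
- have /andP[c0 cle] := cb k.
  rewrite /= normrM normrX (ger0_norm c0) /exp_coeff/= mulrC.
  by rewrite ler_wpM2l// exprn_ge0.
Qed.

Lemma psumP c x : fact_bounded c -> pseries c x @ \oo --> psum c x.
Proof. exact: fact_bounded_cvg. Qed.

Lemma is_derive_psum c x : fact_bounded c ->
  is_derive x (1 : R) (psum c) (psum (pseries_diffs c) x).
Proof.
move=> cb; have cb1 := fact_bounded_diffs cb.
have cb2 := fact_bounded_diffs cb1.
apply: (@pseries_snd_diffs _ _ (`|x| + 1)); try exact: fact_bounded_cvg.
by rewrite [ltRHS]ger0_norm// ltrDl.
Qed.

Lemma psum_ge0 c x : fact_bounded c -> 0 <= x -> 0 <= psum c x.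
Proof.
move=> cb x0; apply: limr_ge; first exact: fact_bounded_cvg.
apply: nearW => n; apply: sumr_ge0 => k _.
by rewrite mulr_ge0 ?exprn_ge0//; have /andP[] := cb k.
Qed.

Lemma psum0 c : psum c 0 = c 0.
Proof.
apply/cvg_lim => //; apply: cvg_near_cst; exists 1%N => // -[|n]//= _.
rewrite /pseries /series/= big_nat_recl//= expr0 mulr1.
by rewrite big1 ?addr0// => i _; rewrite expr0n/= mulr0.
Qed.

(** Multiplication of a power series by its variable, seen on coefficients. *)
Definition pshift c : R^nat := fun k => if k is k'.+1 then c k' else 0.

Lemma cvg_pshift c x l : pseries c x @ \oo --> l ->
  pseries (pshift c) x @ \oo --> x * l.
Proof.
move=> cl; rewrite -(cvg_shiftn 1) /=.
rewrite (_ : (fun _ => _) = (fun n => x * pseries c x n)).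
  exact: cvgMr.
apply/funext => n; rewrite addn1 /pseries /series/= big_nat_recl//= mul0r add0r.
by rewrite mulr_sumr; apply: eq_bigr => i _; rewrite exprS; ring.
Qed.

End power_series.

(** * Stirling series and the differential equations for p_j and q_j *)

Section stirling.
Variable R : realType.

Lemma stirling1_gt k j : (k < j)%N -> stirling1 k j = 0%N.
Proof.
elim: k j => [|k IH] [|j]//= kj.
by rewrite !IH ?muln0//; exact: ltnW.
Qed.

Lemma stirling1_le_fact k j : (stirling1 k j <= k`!)%N.
Proof.
elim: k j => [|k IH] [|j]//=.
by rewrite factS mulSn addnC leq_add// leq_mul.
Qed.

Definition Ecoef (j : nat) : R^nat :=
  fun k => (stirling1 k j)%:R / (k`!%:R * k`!%:R).

Lemma fact_neq0 k : (k`!%:R : R) != 0.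
Proof. by rewrite pnatr_eq0 -lt0n fact_gt0. Qed.

Lemma Ecoef_bounded j : fact_bounded (Ecoef j).
Proof.
move=> k; rewrite /Ecoef mulr_ge0 ?invr_ge0 ?mulr_ge0//= invfM mulrA.
rewrite ler_piMl ?invr_ge0// ler_pdivrMr ?ltr0n ?fact_gt0// mul1r ler_nat.
exact: stirling1_le_fact.
Qed.

Definition Dcoef (j : nat) : R^nat := pseries_diffs (Ecoef j.+1).

Lemma Dcoef_bounded j : fact_bounded (Dcoef j).
Proof. exact/fact_bounded_diffs/Ecoef_bounded. Qed.

Lemma DcoefE j k : Dcoef j k = (stirling1 k.+1 j.+1)%:R / (k`!%:R * k.+1`!%:R).
Proof.
rewrite /Dcoef /pseries_diffs /Ecoef factS natrM.
have k0 : (k.+1%:R : R) != 0 by rewrite pnatr_eq0.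
have := fact_neq0 k; move: (stirling1 _ _) => s f0.
move: (k.+1%:R) k0 => K K0.
by field; rewrite K0 f0.
Qed.

(** [pfun] and [qfun] are differentiable on the whole line and replace [p_] (everywhere) and [q_]
    (for positive arguments). *)
Definition pfun j (x : R) := expR (- x) * psum (Ecoef j) x.
Definition qfun j (x : R) := expR (- x) * psum (Dcoef j) x.

(** The sum in [p_] starts at k = j; the terms of the full series below j vanish because s(k,j) = 0
    for k < j. *)
Lemma p_E j t : p_ j t = pfun j t.
Proof.
rewrite /p_ /pfun /psum; congr (_ * _); congr (lim (_ @ \oo)); apply/funext => n.
rewrite /pseries /series/=.
have [nj|jn] := ltnP n j.
  rewrite (big_geq (ltnW nj)) big_nat_cond; apply/esym/big1.
  move=> k /andP[/andP[_ kn] _].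
  by rewrite /Ecoef stirling1_gt ?mul0r//; exact: ltn_trans kn nj.
rewrite [RHS](big_cat_nat (leq0n j) jn)/= [X in _ = X + _]big_nat_cond.
rewrite [X in _ = X + _]big1 ?add0r.
  apply: eq_bigr => k _; rewrite /Ecoef; have := fact_neq0 k => f0.
  by field.
by move=> k /andP[/andP[_ kj] _]; rewrite /Ecoef stirling1_gt ?mul0r.
Qed.

(* The recurrence of the Stirling numbers, read coefficientwise. *)
Lemma psum_ode j x :
  psum (Dcoef j) x + x * psum (pseries_diffs (Dcoef j)) x - x * psum (Dcoef j) x
  = psum (Ecoef j) x.
Proof.
have b1 := Dcoef_bounded j; have b2 := fact_bounded_diffs b1.
apply: (cvg_unique _ (_ : pseries (Ecoef j) x @ \oo --> _)) => //; last first.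
  exact/psumP/Ecoef_bounded.
rewrite (_ : pseries (Ecoef j) x =
  pseries (Dcoef j) x \+ pseries (pshift (pseries_diffs (Dcoef j))) x
  \- pseries (pshift (Dcoef j)) x).
  by apply: cvgB; [apply: cvgD|]; [|apply: cvg_pshift..]; exact: psumP.
apply/funext => n; rewrite /pseries /series/= -big_split/= -sumrB.
apply: eq_bigr => k _; rewrite -mulrDl -mulrBl; congr (_ * _).
(* At k = 0 both shifted sequences vanish and the recurrence degenerates to s(1,j+1) = s(0,j). *)
case: k => [|k]; rewrite [pshift _ _]/= [pshift (Dcoef j) _]/=.
  by rewrite subr0 addr0 DcoefE /Ecoef /= mul0n add0n fact0.
rewrite /pseries_diffs !DcoefE /Ecoef.
have -> : stirling1 k.+2 j.+1 = (k.+1 * stirling1 k.+1 j.+1 + stirling1 k.+1 j)%N.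
  by [].
move: (stirling1 k.+1 j.+1) (stirling1 k.+1 j) => s s'.
rewrite (factS k.+1) (factS k) !natrM natrD natrM -(natr1 k.+1).
have := fact_neq0 k; have : (k.+1%:R : R) != 0 by rewrite pnatr_eq0.
have : (k.+1%:R + 1 : R) != 0 by rewrite natr1 pnatr_eq0.
move: (k.+1%:R) => K K1 K0 f0.
by field; rewrite f0 K0 K1.
Qed.

Lemma is_derive_expRN (x : R) :
  is_derive x (1 : R) (fun y => expR (- y)) (- expR (- x)).
Proof. by apply: is_derive_eq; rewrite /GRing.scale/=; ring. Qed.

Lemma is_derive_pfun j (x : R) :
  is_derive x (1 : R) (pfun j.+1) (qfun j x - pfun j.+1 x).
Proof.
have h1 := is_derive_expRN x.
have h2 := is_derive_psum (R := R) x (Ecoef_bounded j.+1).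
apply: (is_derive_eq (is_deriveM _ _)).
rewrite /qfun /pfun /Dcoef /GRing.scale /=; ring.
Qed.

(** The product rule gives e^{-x} (D + x D' - x D) with D = E_{j+1}', which [psum_ode] turns into
    e^{-x} E_j. This is what makes [qfun] the running average of [pfun]. *)
Lemma is_derive_qfun_mul j (x : R) :
  is_derive x (1 : R) (fun y => y * qfun j y) (pfun j x).
Proof.
have h1 := is_derive_expRN x.
have h2 := is_derive_psum (R := R) x (Dcoef_bounded j).
have h3 : is_derive x (1 : R) (qfun j)
  (expR (- x) * psum (pseries_diffs (Dcoef j)) x - qfun j x).
  apply: (is_derive_eq (is_deriveM _ _)).
  rewrite /qfun /GRing.scale /=; ring.
apply: (is_derive_eq (is_deriveM _ _)).
rewrite /pfun -psum_ode /qfun /GRing.scale /=; ring.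
Qed.

Lemma is_derive_continuous (f : R -> R) (df : R -> R) :
  (forall x, is_derive x (1 : R) f (df x)) -> continuous f.
Proof.
move=> fdf x; apply: differentiable_continuous.
by apply/derivable1_diffP; have [] := fdf x.
Qed.

Lemma continuous_psum (c : R^nat) : fact_bounded c -> continuous (psum c).
Proof.
by move=> cb; apply: is_derive_continuous => x; exact: is_derive_psum.
Qed.

Lemma continuous_pfun j : continuous (pfun j).
Proof.
move=> x; apply: cvgM; last exact/continuous_psum/Ecoef_bounded.
exact: (is_derive_continuous is_derive_expRN).
Qed.

Lemma continuous_qfun j : continuous (qfun j).
Proof.
move=> x; apply: cvgM; last exact/continuous_psum/Dcoef_bounded.
exact: (is_derive_continuous is_derive_expRN).
Qed.

Lemma qfun_ge0 j x : 0 <= x -> 0 <= qfun j x.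
Proof. by move=> x0; rewrite mulr_ge0 ?expR_ge0// psum_ge0//; exact: Dcoef_bounded. Qed.

Lemma pfunS0 j : pfun j.+1 0 = 0.
Proof. by rewrite /pfun psum0 /Ecoef/= mul0r mulr0. Qed.

Lemma integral_is_derive (f F : R -> R) (t : R) : 0 < t -> continuous f ->
  (forall x, is_derive x (1 : R) F (f x)) ->
  (\int[lebesgue_measure]_(x in `[0%R, t]) (f x)%:E = (F t - F 0)%:E)%E.
Proof.
move=> t0 cf dF; rewrite EFinB; apply: continuous_FTC2 => //.
- exact: continuous_subspaceT.
- have cF := is_derive_continuous dF.
  split.
  + by move=> x _; have [] := dF x.
  + exact/cvg_at_right_filter/cF.
  + exact/cvg_at_left_filter/cF.
- by move=> x _; rewrite derive1E; have [] := dF x.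
Qed.

Lemma q_E j t : 0 < t -> q_ j t = qfun j t.
Proof.
move=> t0; rewrite /q_ /Rintegral.
under eq_integral do rewrite p_E.
rewrite (integral_is_derive t0 (@continuous_pfun j) (is_derive_qfun_mul j)) /=.
by rewrite mul0r subr0 mulKf// gt_eqF.
Qed.

Lemma pfun0E : pfun 0 = fun x => expR (- x).
Proof.
apply/funext => x; rewrite /pfun (_ : psum _ _ = 1) ?mulr1//.
apply/cvg_lim => //; apply: cvg_near_cst; exists 1%N => // -[|n]//= _.
rewrite /pseries /series/= big_nat_recl//= expr0 mulr1 big1 ?addr0.
  by rewrite /Ecoef/= fact0 mulr1 divr1.
by move=> i _; rewrite /Ecoef/= !mul0r.
Qed.

(** Both x q_0(x) and -e^{-x} are antiderivatives of p_0(x) = e^{-x}; their increments over [0, x]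
    agree. *)
Lemma qfun0E x : 0 < x -> x * qfun 0 x = 1 - expR (- x).
Proof.
move=> x0.
have d0 y : is_derive y (1 : R) (fun z : R => - expR (- z)) (pfun 0 y).
  rewrite pfun0E; have h := is_derive_expRN y.
  by apply: is_derive_eq; ring.
have := integral_is_derive x0 (@continuous_pfun 0) (is_derive_qfun_mul 0).
rewrite (integral_is_derive x0 (@continuous_pfun 0) d0) => -[].
by rewrite oppr0 expR0 mul0r subr0 => <-; ring.
Qed.

(* (1 - e^{x-t})(p + p') is the derivative of V + (1 - e^{x-t}) p when V' = p *)
Lemma qfun_kernel j t : 0 < t ->
  (\int[lebesgue_measure]_(x in `[0%R, t])
     ((1 - expR (x - t)) * qfun j x)%:E = (t * qfun j.+1 t)%:E)%E.
Proof.
move=> t0.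
have dE x : is_derive x (1 : R) (fun y : R => expR (y - t)) (expR (x - t)).
  by apply: is_derive_eq; rewrite /GRing.scale/=; ring.
have dF x : is_derive x (1 : R) (fun y => y * qfun j.+1 y + pfun j.+1 y
    - expR (y - t) * pfun j.+1 y) ((1 - expR (x - t)) * qfun j x).
  have h1 := dE x; have h2 := is_derive_pfun j x.
  have h3 := is_derive_qfun_mul j.+1 x.
  apply: is_derive_eq; rewrite /GRing.scale/=; ring.
have cf : continuous (fun x : R => (1 - expR (x - t)) * qfun j x).
  move=> x; apply: cvgM; last exact: continuous_qfun.
  apply: cvgB; first exact: cvg_cst.
  exact: (is_derive_continuous dE).
(* At the upper end the factor 1 - e^{x-t} vanishes, at the lower end p_{j+1} does, so only t
   q_{j+1}(t) survives. *)
rewrite (integral_is_derive t0 cf dF) !pfunS0 subrr expR0.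
by congr EFin; ring.
Qed.

End stirling.

(** * Rising factorials and the generating function of the q_j *)

Lemma sum_stirling1_rising m k :
  ((\sum_(j < k.+1) stirling1 k.+1 j.+1 * m ^ j) * m`! = (m + k)`!)%N.
Proof.
elim: k => [|k IH]; first by rewrite big_ord1 /= addn0 !mul1n.
(* The sum is (m+1)...(m+k), a rising factorial without its factor m. In the recurrence the first
   term supplies the factor k+1 and the second, after an index shift, the factor m; the boundary
   Stirling numbers are zero. *)
have -> : (\sum_(j < k.+2) stirling1 k.+2 j.+1 * m ^ j =
           (m + k.+1) * \sum_(j < k.+1) stirling1 k.+1 j.+1 * m ^ j)%N.
  under eq_bigr => j _ do
    rewrite [stirling1 _ _]/(k.+1 * stirling1 k.+1 j.+1 + stirling1 k.+1 j)%N mulnDl.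
  rewrite big_split/= addnC mulnDl; congr (_ + _)%N.
    rewrite big_ord_recl [stirling1 _ _]/= mul0n add0n big_distrr/=.
    by apply: eq_bigr => j _; rewrite /bump/= add1n expnS mulnCA.
  rewrite big_ord_recr/= (@stirling1_gt k k.+2)// (@stirling1_gt k k.+1)//.
  rewrite !muln0 mul0n addn0 [RHS]big_distrr/=; apply: eq_bigr => j _.
  by rewrite -mulnA.
by rewrite -mulnA IH addnS factS.
Qed.

Section generating_function.
Variable R : realType.
Implicit Types (c : R^nat) (x : R).

(** The closed form of sum_j (m+1)^j q_j(x); its leading coefficient is 1/(m+1)!. *)
Definition qgen (m : nat) (x : R) : R :=
  \sum_(n < m.+1) 'C(m, n)%:R / (n.+1)`!%:R * x ^+ n.

Lemma iter_pshiftE n c k : iter n (@pshift R) c k = if (n <= k)%N then c (k - n)%N else 0.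
Proof. by elim: n k => [|n IH] [|k]//=; rewrite IH. Qed.

Lemma cvg_iter_pshift n c x l : pseries c x @ \oo --> l ->
  pseries (iter n (@pshift R) c) x @ \oo --> x ^+ n * l.
Proof.
move=> cl; elim: n => [|n IH] /=; first by rewrite expr0 mul1r.
by rewrite exprS -mulrA; exact: cvg_pshift.
Qed.

(** Taylor coefficients of [qgen m x * expR x], that is, of sum_j (m+1)^j E_{j+1}'. *)
Definition qgen_coef m : R^nat := fun k => 'C(m.+1 + k, k)%:R / k.+1`!%:R.

(** Vandermonde splits C(m+k+1, k) into the products C(m,n) C(k+1,k-n), and C(k+1,k-n)/(k+1)! =
    1/((n+1)! (k-n)!). *)
Lemma qgen_coefE m k : qgen_coef m k =
  \sum_(n < m.+1) 'C(m, n)%:R / (n.+1)`!%:R *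
    iter n (@pshift R) (fun i => i`!%:R^-1) k.
Proof.
transitivity (\sum_(n < k.+1) 'C(m, n)%:R / (n.+1)`!%:R * ((k - n)`!%:R^-1 : R)).
  rewrite /qgen_coef addSnnS -binomial.Vandermonde natr_sum mulr_suml.
  apply: eq_bigr => n _; rewrite natrM -!mulrA; congr (_ * _).
  have nk : (n <= k)%N by rewrite -ltnS.
  have := bin_fact (leq_trans (leq_subr n k) (leqnSn k)).
  rewrite subSn ?leq_subr// subKn// => /(congr1 (fun i => i%:R : R)).
  rewrite 2!natrM => <-.
  have f1 := fact_neq0 R (k - n); have f2 := fact_neq0 R n.+1.
  have f3 : ('C(k.+1, k - n)%:R : R) != 0.
    by rewrite pnatr_eq0 -lt0n bin_gt0 (leq_trans (leq_subr _ _)).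
  by field; rewrite f1 f2 f3.
set G := fun n : nat => 'C(m, n)%:R / (n.+1)`!%:R *
    iter n (@pshift R) (fun i => i`!%:R^-1) k.
transitivity (\sum_(n < k.+1) G n).
  apply: eq_bigr => n _; rewrite /G iter_pshiftE ifT//.
  by rewrite -ltnS.
(* Both index ranges are widened to a common one: C(m,n) = 0 for n > m, and the shifted sequence
   vanishes for n > k. *)
rewrite (big_ord_widen _ G (leq_addr m k.+1)).
rewrite [RHS](big_ord_widen _ G (leq_addl k m.+1)) addSnnS addnC.
rewrite [LHS]big_mkcond [RHS]big_mkcond /=; apply: eq_bigr => n _.
rewrite !ltnS; case: leqP => nk; case: leqP => // nm; rewrite /G.
  by rewrite bin_small// !mul0r.
by rewrite iter_pshiftE leqNgt nk mulr0.
Qed.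

Lemma cvg_qgen m x : pseries (qgen_coef m) x @ \oo --> qgen m x * expR x.
Proof.
rewrite /qgen mulr_suml.
rewrite (_ : pseries _ _ = \sum_(n < m.+1)
   (fun N => 'C(m, n)%:R / (n.+1)`!%:R *
     pseries (iter n (@pshift R) (fun i => i`!%:R^-1)) x N)); last first.
  apply/funext => N; rewrite fct_sumE /pseries /series/=.
  under eq_bigr do rewrite qgen_coefE mulr_suml.
  rewrite exchange_big/=; apply: eq_bigr => n _; rewrite mulr_sumr.
  by apply: eq_bigr => k _; rewrite mulrA.
apply: (big_ind2 (fun (u : R^nat) l => u @ \oo --> l)) => [|u l v l'|n _].
- exact: cvg_cst.
- exact: cvgD.
rewrite -(mulrA _ (x ^+ n)); apply: cvgMr; apply: cvg_iter_pshift.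
by rewrite expRE; apply: fact_bounded_cvg => k; rewrite lexx invr_ge0 ler0n.
Qed.

Lemma EFin_pseries c x l : pseries c x @ \oo --> l ->
  (\sum_(k <oo) (c k * x ^+ k)%:E = l%:E)%E.
Proof.
move=> cl; apply/cvg_lim => //.
rewrite (_ : (fun _ => _) = EFin \o pseries c x); first by apply: cvg_comp cl _.
by apply/funext => n; rewrite /= /pseries /series/= -sumEFin.
Qed.

Lemma nneseries_ord (f : nat -> \bar R) n : (forall k, (n <= k)%N -> f k = 0%E) ->
  (\sum_(k <oo) f k = \sum_(k < n) f k)%E.
Proof.
move=> f0; apply/cvg_lim => //; apply: cvg_near_cst; exists n => // N /= nN.
rewrite (big_cat_nat (leq0n n) nN)/= [X in (_ + X)%E]big_nat_cond.
rewrite [X in (_ + X)%E]big1 ?adde0 ?big_mkord//.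
by move=> k /andP[/andP[nk _] _]; exact: f0.
Qed.

(** All terms are nonnegative, so the sums over j and k may be exchanged. For fixed k the sum over j
    stops at k and is a rising factorial at m+1, which yields [qgen_coef m k]; the resulting e^x
    cancels the prefactor e^{-x}. *)
Lemma qfun_generating m x : 0 <= x ->
  (\sum_(j <oo) (m.+1%:R ^+ j * qfun j x)%:E = (qgen m x)%:E)%E.
Proof.
move=> x0.
have D0 j k : 0 <= Dcoef R j k by have /andP[] := Dcoef_bounded R j k.
transitivity (\sum_(j <oo) ((expR (- x))%:E *
    \sum_(k <oo) (m.+1%:R ^+ j * (Dcoef R j k * x ^+ k))%:E))%E.
  apply: eq_eseriesr => j _.
  rewrite (_ : (\sum_(k <oo) _)%E = (m.+1%:R ^+ j * psum (Dcoef R j) x)%:E).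
    by rewrite -EFinM /qfun; congr EFin; ring.
  rewrite EFinM -(EFin_pseries (@psumP R _ x (Dcoef_bounded R j))).
  rewrite -nneseriesZl//.
  by move=> k _; rewrite lee_fin mulr_ge0// exprn_ge0.
rewrite nneseriesZl; last first.
  by move=> j _; apply: nneseries_ge0 => k _ _; rewrite lee_fin !mulr_ge0// exprn_ge0.
rewrite nneseries_interchange; last first.
  by move=> j k; rewrite lee_fin !mulr_ge0// exprn_ge0.
transitivity ((expR (- x))%:E * \sum_(k <oo) (qgen_coef m k * x ^+ k)%:E)%E.
  congr (_ * _)%E; apply: eq_eseriesr => k _.
  rewrite (@nneseries_ord _ k.+1); last first.
    by move=> j kj; rewrite DcoefE stirling1_gt// !mul0r mulr0.
  rewrite sumEFin; congr EFin.
  under eq_bigr do rewrite mulrA.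
  rewrite -mulr_suml; congr (_ * _).
  have := sum_stirling1_rising m.+1 k => /(congr1 (fun i => i%:R : R)).
  have := bin_fact (leq_addl m.+1 k); rewrite addnK => <-.
  have f1 := fact_neq0 R k; have f3 := fact_neq0 R k.+1.
  have := fact_neq0 R m.+1; move: (m.+1)`! => F f2.
  rewrite !natrM natr_sum => h; rewrite /qgen_coef.
  transitivity ((\sum_(i < k.+1) (stirling1 k.+1 i.+1 * m.+1 ^ i)%:R) / (k`!%:R * k.+1`!%:R) : R).
    rewrite mulr_suml; apply: eq_bigr => j _; rewrite DcoefE natrM natrX.
    by rewrite mulrCA mulrA.
  apply: (mulIf f2); rewrite mulrAC h.
  by field; rewrite f1 f3.
rewrite (EFin_pseries (@cvg_qgen m x)) -EFinM mulrCA -expRD addNr expR0 mulr1//.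
Qed.

(** Solves for the top term of [qgen], so that each moment can be computed from the integral of
    [qgen m] and lower moments. *)
Lemma qgen_moment m x : x ^+ m = (m.+1)`!%:R *
  (qgen m x - \sum_(n < m) 'C(m, n)%:R / (n.+1)`!%:R * x ^+ n).
Proof.
rewrite /qgen big_ord_recr/= addrAC subrr add0r binn mul1r mulrA divff ?mul1r//.
Qed.

End generating_function.

(** * Moments on a bounded interval *)

Lemma probability_compl0 d (T : measurableType d) (R : realType)
    (P : probability T R) (D : set T) :
  measurable D -> P D = 1%E -> P (~` D) = 0%E.
Proof. by move=> mD PD; rewrite probability_setC// PD subee. Qed.

Lemma probability_concentrated d (T : measurableType d) (R : realType)
    (P : probability T R) (B A : set T) :
  measurable B -> measurable A -> P B = 1%E -> P A = P (B `&` A).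
Proof.
move=> mB mA PB; have PB0 := probability_compl0 mB PB.
rewrite (measureDI P mA mB) [X in (X + _)%E](_ : _ = 0%E) ?add0e 1?setIC//.
apply: (subset_measure0 _ _ _ PB0) => //.
- exact: measurableD.
- exact: measurableC.
Qed.

Section moments.
Variable R : realType.

Lemma bernoulli_ineq (u : R) k : -1 <= u -> 1 + k%:R * u <= (1 + u) ^+ k.
Proof.
move=> u1; elim: k => [|k IH]; first by rewrite mul0r addr0 expr0.
have h : 0 <= 1 + u by lra.
rewrite exprS (le_trans _ (ler_wpM2l h IH))// -natr1.
have : 0 <= k%:R * (u * u) by rewrite mulr_ge0// -expr2 sqr_ge0.
by move: (k%:R) => K; nra.
Qed.

Lemma cvg_natr_expr (r : R) : 0 <= r < 1 -> (fun n => n%:R * r ^+ n) @ \oo --> 0.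
Proof.
move=> /andP[r0 r1].
have e0 : 0 < 1 - r by lra.
(* Bernoulli gives n (1-r) <= (2-r)^n, and the ratio (2-r) r = 1 - (1-r)^2 is below 1. *)
apply: (@squeeze_cvgr _ _ _ _ (cst 0) (geometric (1 - r)^-1 ((2 - r) * r))).
- apply: nearW => n; rewrite /= mulr_ge0 ?exprn_ge0//=.
  rewrite ler_pdivlMl// exprMn mulrA ler_wpM2r ?exprn_ge0//.
  have h : 1 + n%:R * (1 - r) <= (2 - r) ^+ n.
    have -> : 2 - r = 1 + (1 - r) by lra.
    by apply: bernoulli_ineq; lra.
  by apply: le_trans h; rewrite mulrC lerDr.
- exact: cvg_cst.
- by apply: cvg_geometric; rewrite ger0_norm; nra.
Qed.

(* (1 - l^n)^(n 2^n) is a polynomial approximation of the indicator of l < 1/2 on [0, 1]: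
   Bernoulli's inequality bounds it below by 1 - n (2l)^n and above by 1 / (1 + n (2l)^n). *)
Lemma cvg_step (l : R) : 0 <= l <= 1 ->
  (fun n => (1 - l ^+ n) ^+ (n * 2 ^ n)) @ \oo --> ((l < 2^-1)%R%:R : R).
Proof.
move=> /andP[l0 l1].
have ln n : 0 <= l ^+ n <= 1 by rewrite exprn_ge0//= exprn_ile1.
have kE n : (n * 2 ^ n)%:R * l ^+ n = n%:R * (2 * l) ^+ n.
  by rewrite natrM natrX exprMn mulrA.
case: ltP => l2.
- apply: (@squeeze_cvgr _ _ _ _ (fun n => 1 - n%:R * (2 * l) ^+ n) (cst 1)).
  + apply: nearW => n; have /andP[a b] := ln n; apply/andP; split.
      rewrite -kE; have := @bernoulli_ineq (- l ^+ n) (n * 2 ^ n).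
      by rewrite mulrN; apply; lra.
    by rewrite exprn_ile1//; lra.
  + rewrite -[X in _ --> X]subr0; apply: cvgB; first exact: cvg_cst.
    by apply: cvg_natr_expr; lra.
  + exact: cvg_cst.
- apply: (@squeeze_cvgr _ _ _ _ (cst 0) (@harmonic R)).
  + apply: nearW => n; have /andP[a b] := ln n.
    rewrite exprn_ge0 ?subr_ge0//= /harmonic/=.
    have n0 : 0 < n.+1%:R :> R by rewrite ltr0n.
    rewrite -div1r ler_pdivlMr//.
    (* The second factor is at least 1 + n (2l)^n >= n + 1 since 2l >= 1, while the product is a
       power of 1 - l^{2n} <= 1. *)
    apply: (@le_trans _ _ ((1 - l ^+ n) ^+ (n * 2 ^ n) * (1 + l ^+ n) ^+ (n * 2 ^ n))).
      rewrite ler_wpM2l ?exprn_ge0 ?subr_ge0//.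
      rewrite (le_trans _ (bernoulli_ineq _ _))//; last by lra.
      rewrite kE -natr1 addrC lerD2l ler_peMr// exprn_ege1//; lra.
    rewrite -exprMn exprn_ile1//; nra.
  + exact: cvg_cst.
  + exact: cvg_harmonic.
Qed.

Lemma continuous_integrable (P : probability R R) (t : R) (f : R -> R) :
  continuous f -> P.-integrable `[0%R, t] (EFin \o f).
Proof.
move=> cf; apply: measurable_bounded_integrable => //.
- by rewrite -ge0_fin_numE// fin_num_measure.
- by apply: measurable_funTS; exact: continuous_measurable_fun.
- have cfD : {within `[0, t], continuous f} by exact: continuous_subspaceT.
  have /compact_bounded[M [_ h]] := continuous_compact cfD (@segment_compact R 0 t).
  by exists M; split; rewrite ?num_real// => ? ? ? ?; exact: h.
Qed.

Section determinacy.
Variables (P1 P2 : probability R R) (t : R).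
Let D := `[0, t]%classic : set R.
Let mD : measurable D. Proof. exact: measurable_itv. Qed.
Hypothesis t0 : 0 < t.
Hypotheses (P1D : P1 D = 1%E) (P2D : P2 D = 1%E).
Hypothesis eq_moments : forall n : nat,
  (\int[P1]_(x in D) (x ^+ n)%:E = \int[P2]_(x in D) (x ^+ n)%:E)%E.

Lemma eq_integral_poly (p : {poly R}) :
  (\int[P1]_(x in D) (p.[x])%:E = \int[P2]_(x in D) (p.[x])%:E)%E.
Proof.
have E (P : probability R R) : (\int[P]_(x in D) (p.[x])%:E =
   \sum_(i < size p) (p`_i)%:E * \int[P]_(x in D) (x ^+ i)%:E)%E.
  have iX (i : nat) : P.-integrable D (fun x => (x ^+ i)%:E).
    by apply: continuous_integrable => x; exact: exprn_continuous.
  under eq_integral => x _.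
    rewrite horner_coef -sumEFin.
    under eq_bigr do rewrite EFinM.
    over.
  rewrite integral_sum//; last by move=> i; exact: integrableZl.
  by apply: eq_bigr => i _; rewrite integralZl.
by rewrite !E; apply: eq_bigr => i _; rewrite eq_moments.
Qed.

(** The indicator of the ray is a bounded pointwise limit on [D] of polynomials, namely [cvg_step]
    composed with an affine map; dominated convergence carries the equality of polynomial integrals
    to the limit. *)
Lemma eq_upper_ray (c : R) : 0 <= c <= t -> P1 (D `&` `]c, +oo[) = P2 (D `&` `]c, +oo[).
Proof.
move=> /andP[c0 ct].
(* The slope 1/(2t) keeps [l] within [0, 1] on [D], where |x - c| <= t, and [l] drops below 1/2
   exactly beyond c. *)
pose l : {poly R} := (2^-1)%:P - (2 * t)^-1 *: ('X - c%:P).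
have lE x : l.[x] = 2^-1 - (2 * t)^-1 * (x - c).
  by rewrite /l !hornerE.
have l01 x : D x -> 0 <= l.[x] <= 1.
  rewrite /D/= in_itv/= => /andP[x0 xt]; rewrite lE.
  have -> : (2 * t)^-1 * (x - c) = (x - c) / t / 2 by field; rewrite gt_eqF.
  have : -1 <= (x - c) / t <= 1.
    rewrite ler_pdivrMr// ler_pdivlMr//; lra.
  by move: ((x - c) / t) => z; lra.
have lc x : (l.[x] < 2^-1) = (c < x).
  by rewrite lE ltrBlDr ltrDl pmulr_rgt0 ?subr_gt0// invr_gt0 mulr_gt0.
pose S n : {poly R} := (1 - l ^+ n) ^+ (n * 2 ^ n).
have SE n x : (S n).[x] = (1 - l.[x] ^+ n) ^+ (n * 2 ^ n).
  by rewrite /S !(horner_exp, hornerE).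
have lim (P : probability R R) :
    (\int[P]_(x in D) ((S n).[x])%:E)%E @[n --> \oo] --> P (D `&` `]c, +oo[).
  have -> : P (D `&` `]c, +oo[) = (\int[P]_(x in D) (\1_(`]c, +oo[) x)%:E)%E.
    by rewrite integral_indic// setIC.
  pose f_ n (x : R) := ((S n).[x])%:E; pose f (x : R) := (\1_(`]c, +oo[%classic) x : R)%:E.
  have mf_ n : measurable_fun D (f_ n) by apply/measurable_EFinP; exact: measurable_poly.
  have mf : measurable_fun D f.
    by apply/measurable_EFinP; exact: measurable_indic.
  have f_f : {ae P, forall x, D x -> f_ ^~ x @ \oo --> f x}.
    apply: aeW => x Dx; apply: cvg_EFin; first exact: nearW.
    rewrite indicE mem_setE in_itv/= andbT -lc.
    rewrite (_ : _ \o _ = (fun n => (1 - l.[x] ^+ n) ^+ (n * 2 ^ n))).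
      by apply: cvg_step; exact: l01.
    by apply/funext => n /=; rewrite SE.
  have ig : P.-integrable D (EFin \o cst 1) by exact: finite_measure_integrable_cst.
  have f_g : {ae P, forall x n, D x -> (`|f_ n x| <= (EFin \o cst 1%R) x)%E}.
    apply: aeW => x n Dx; rewrite /f_ /= lee_fin SE.
    have /andP[a b] := l01 _ Dx.
    have /andP[la lb] : 0 <= l.[x] ^+ n <= 1 by rewrite exprn_ge0// exprn_ile1.
    by rewrite ger0_norm ?exprn_ge0 ?exprn_ile1//; lra.
  by have [_ _] := dominated_convergence mD mf_ mf f_f ig f_g.
apply: (cvg_unique _ (lim P1)) => //.
rewrite (_ : (fun n : nat => _) = (fun n => (\int[P2]_(x in D) ((S n).[x])%:E)%E)).
  exact: lim.
by apply/funext => n; exact: eq_integral_poly.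
Qed.


(** Rays starting outside [0, t] carry mass 1 or 0, the others are covered by [eq_upper_ray].
    Differences of rays are the half-open intervals, which generate the Borel sets. *)
Theorem eq_moments_measure (A : set R) : measurable A -> P1 A = P2 A.
Proof.
have mray (c : R) : measurable (`]c, +oo[%classic : set R) by exact: measurable_itv.
have fin (P : probability R R) (c : R) : (P `]c, +oo[%classic < +oo)%E.
  by rewrite -ge0_fin_numE// fin_num_measure.
have ray (c : R) : P1 `]c, +oo[%classic = P2 `]c, +oo[%classic.
  rewrite (probability_concentrated mD (mray c) P1D) (probability_concentrated mD (mray c) P2D).
  have [c0|c0] := ltP c 0.
    rewrite (_ : D `&` _ = D) ?P1D ?P2D//; apply/setIidPl => x.
    by rewrite /D/= !in_itv/= andbT => /andP[x0 _]; exact: lt_le_trans x0.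
  have [ct|ct] := leP c t; first by apply: eq_upper_ray; rewrite c0.
  rewrite (_ : D `&` _ = set0) ?measure0//; apply/seteqP; split => // x [].
  rewrite /D/= !in_itv/= andbT => /andP[_ xt] cx.
  by have := lt_le_trans (lt_trans ct cx) xt; rewrite ltxx.
move: A; apply: (measure_unique (@ocitv R) (fun n => `]-n%:R, n%:R]%classic)) => //.
- exact: ocitvI.
- by move=> n; exact: is_ocitv.
- apply/seteqP; split => // x _; exists (Num.truncn `|x|).+1 => //=.
  have := truncnS_gt `|x|; rewrite in_itv/= ltr_norml => /andP[-> /ltW].
  by [].
- move=> _ [[a b] _ <-] /=.
  have -> : `]a, b]%classic = `]a, +oo[%classic `\` `]b, +oo[%classic :> set R.
    apply/seteqP; split => x /=; rewrite !in_itv/= !andbT.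
      by move=> /andP[-> xb]; split => //; apply/negP; rewrite -leNgt.
    by move=> [-> /negP]; rewrite -leNgt.
  have [ab|ba] := leP a b.
    have sub : `]a, +oo[%classic `&` `]b, +oo[%classic = `]b, +oo[%classic :> set R.
      apply/setIidPr => x /=; rewrite !in_itv/= !andbT; exact: le_lt_trans.
    rewrite (measureD (mray a) (mray b) (fin P1 a)).
    by rewrite (measureD (mray a) (mray b) (fin P2 a)) sub; congr (_ - _)%E; exact: ray.
  rewrite (_ : _ `\` _ = set0) ?measure0//; apply/seteqP; split => // x /=.
  rewrite !in_itv/= !andbT => -[ax]; apply; exact: lt_trans ax.
- by move=> k; rewrite -ge0_fin_numE// fin_num_measure.
Qed.

End determinacy.
End moments.

(** * Reduction to integral equations *)

Section full_set.
Local Open Scope ereal_scope.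
Import HBNNSimple.

(* No measurability of f is assumed: the kernel is unconstrained at negative states. *)
Lemma ge0_integral_full d (T : measurableType d) (R : realType)
    (mu : {measure set T -> \bar R}) (D : set T) (f : T -> \bar R) :
  measurable D -> mu (~` D) = 0 -> (forall x, 0 <= f x) ->
  \int[mu]_x f x = \int[mu]_(x in D) f x.
Proof.
move=> mD muD f0; rewrite ge0_integralTE// ge0_integralE//.
apply/eqP; rewrite eq_le; apply/andP; split; last first.
  apply: le_ereal_sup => _ [h /= hf <-]; exists h => //= x.
  by rewrite (le_trans (hf x))// patchE; case: ifP.
(* A simple function below f is cut down to [D]: it then lies below the restriction of f and keeps
   its integral, the complement of [D] being null. *)
apply/ge_ereal_sup => _ [h /= hf <-].
apply: ereal_sup_ubound; exists (proj_nnsfun h mD) => /=.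
  move=> x; rewrite -[X in _ <= X]/(_ x) patchE mindicE.
  by case: ifP => xD; rewrite ?mulr1 ?mulr0.
have -> : sintegral mu h = \int[mu]_x (h x)%:E.
  by rewrite integral_nnsfun// patch_setT.
rewrite (@ge0_negligible_integral _ _ _ _ _ (~` D))//.
- by rewrite setTD setCK integral_nnsfun// mrestrict.
- exact: measurableC.
- exact/measurable_EFinP.
- by move=> x _; rewrite lee_fin.
Qed.

End full_set.

Lemma adde_EFinI (R : realType) (r y : R) (x : \bar R) :
  (r%:E + x = r%:E + y%:E)%E -> x = y%:E.
Proof. by case: x => [x| |]// []/addrI ->. Qed.

Section paths.
Variable R : realType.
Variable mu : R -> probability R R.
Local Open Scope ereal_scope.

Definition cnt_le (t : R) (j : nat) (xs : seq R) : \bar R :=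
  ((cnt_in t xs <= j)%N)%:R%:E.

Lemma pathE_ge0 N (f : seq R -> \bar R) s : (forall xs, 0 <= f xs) -> 0 <= pathE mu N f s.
Proof.
elim: N f s => [|N IH] f s f0 //=.
by apply: integral_ge0 => y _; exact: IH.
Qed.

Lemma pathE_0 N s : pathE mu N (fun=> 0) s = 0.
Proof. by elim: N s => [|N IH] s //=; apply: integral0_eq => y _; exact: IH. Qed.

Hypothesis mu00 : mu 0%R [set 0%R] = 1.
Hypothesis mu_lt : forall t : R, (0 < t)%R -> mu t `[0%R, t[%classic = 1.

Lemma cnt_le_cons0 (t : R) j : (fun xs => cnt_le t j (0%R :: xs)) = cnt_le t j.
Proof. by apply/funext => xs; rewrite /cnt_le /cnt_in /= ltxx. Qed.

Lemma cnt_le_cons (t : R) j (y : R) : (0 < y < t)%R ->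
  (fun xs => cnt_le t j (y :: xs)) = if j is j'.+1 then cnt_le t j' else fun=> 0.
Proof.
by move=> yt; apply/funext => xs; rewrite /cnt_le /cnt_in /= yt; case: j.
Qed.

Lemma cnt_le_ge0 t j xs : 0 <= cnt_le t j xs.
Proof. by rewrite lee_fin. Qed.

Lemma pathE_cnt_le0 (t : R) N j : pathE mu N (cnt_le t j) 0%R = 1.
Proof.
elim: N => [//|N IH] /=.
rewrite (@ge0_integral_full _ R R (mu 0%R) [set 0%R])//; last 2 first.
- exact: probability_compl0.
- by move=> x; apply: pathE_ge0 => xs; exact: cnt_le_ge0.
rewrite (eq_integral (cst 1)); last first.
  by move=> x; rewrite inE => ->; rewrite cnt_le_cons0 IH.
by rewrite integral_cst// mul1e.
Qed.

(** First-step analysis: a jump to 0 ends all counting, and a jump into (0, s), hence into (0, t),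
    uses up one allowed visit. The function [g] is a measurable name for the remaining expectation
    on (0, s). *)
Lemma pathE_cnt_leS (t : R) N j (s : R) (g : R -> \bar R) : (0 < s <= t)%R ->
  measurable_fun `]0%R, s[ g -> (forall y, (0 < y < s)%R -> 0 <= g y) ->
  (forall y, (0 < y < s)%R -> pathE mu N (if j is j'.+1 then cnt_le t j' else fun=> 0) y = g y) ->
  pathE mu N.+1 (cnt_le t j) s = mu s [set 0%R] + \int[mu s]_(y in `]0%R, s[) g y.
Proof.
move=> /andP[s0 st] mg g0 IH /=.
rewrite (@ge0_integral_full _ R R (mu s) `[0%R, s[%classic)//; last 2 first.
- exact/probability_compl0/mu_lt.
- by move=> x; apply: pathE_ge0 => xs; exact: cnt_le_ge0.
pose h y := if y == 0%R then 1 else g y.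
rewrite (eq_integral h); last first.
  move=> y; rewrite inE/= in_itv/= /h => /andP[y0 ys].
  case: eqP => [->|/eqP yn0]; first by rewrite cnt_le_cons0 pathE_cnt_le0.
  have y00 : (0 < y)%R by rewrite lt_neqAle eq_sym yn0.
  by rewrite cnt_le_cons ?IH ?y00//= (lt_le_trans ys).
have hg : {in `]0%R, s[%classic, h =1 g}.
  by move=> y; rewrite inE/= in_itv/= /h => /andP[y0 _]; rewrite gt_eqF.
have h0 : {in [set 0%R], h =1 cst 1}.
  by move=> y; rewrite inE/= /h => ->; rewrite eqxx.
have -> : `[0%R, s[%classic = [set 0%R] `|` `]0%R, s[%classic :> set R.
  by rewrite setU1itv.
rewrite ge0_integral_setU//.
- by rewrite (eq_integral _ _ h0) (eq_integral _ _ hg) integral_cst// mul1e.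
- apply/measurable_funU => //; split.
    by apply: (eq_measurable_fun (cst 1)) => // x xE; rewrite h0.
  by apply: (eq_measurable_fun g) => // x xE; rewrite hg.
- move=> x [xE|xE]; first by rewrite h0 ?inE.
  by rewrite hg ?inE//; apply: g0; move: xE; rewrite /= in_itv.
- apply/eqP/seteqP; split => // x [/= ->]; rewrite in_itv/= ltxx//.
Qed.

(** With no visit allowed, the first step must already be absorbed. *)
Lemma pathE_cnt_le_zero (t : R) N (s : R) : (0 < s <= t)%R ->
  pathE mu N.+1 (cnt_le t 0) s = mu s [set 0%R].
Proof.
move=> st; rewrite (@pathE_cnt_leS _ _ _ _ (cst 0) st)//.
- by rewrite integral0 adde0.
- by move=> y _; rewrite pathE_0.
Qed.

Section partial_sums.
Variable q : nat -> R -> R.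
Hypothesis q_ge0 : forall j y, (0 < y)%R -> (0 <= q j y)%R.
Hypothesis q_meas : forall j, measurable_fun setT (q j).
Let S j (y : R) := (\sum_(i < j.+1) q i y)%R.

Let mS j (D : set R) : measurable_fun D (EFin \o S j).
Proof.
apply: measurable_funTS; apply/measurable_EFinP.
by apply: measurable_sum => i; exact: q_meas.
Qed.

Let S_ge0 j y : (0 < y)%R -> (0 <= S j y)%R.
Proof. by move=> y0; apply: sumr_ge0 => i _; exact: q_ge0. Qed.

Lemma pathE_cnt_le_sum (t : R) N j (s : R) : (0 < s <= t)%R ->
  (forall y, (0 < y <= t)%R -> pathE mu N (cnt_le t j) y = (S j y)%:E) ->
  pathE mu N.+1 (cnt_le t j.+1) s =
    mu s [set 0%R] + \int[mu s]_(y in `]0%R, s[) (S j y)%:E.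
Proof.
move=> /andP[s0 st] IH; apply: pathE_cnt_leS; rewrite ?s0//.
- exact: mS.
- by move=> y /andP[y0 _]; rewrite lee_fin S_ge0.
- by move=> y /andP[y0 ys]; apply: IH; rewrite y0/= ltW// (lt_le_trans ys).
Qed.

Lemma P_le_cst (t : R) j c : (forall N, (j < N)%N -> pathE mu N (cnt_le t j) t = c) ->
  P_le mu t j = c.
Proof.
move=> h; apply/cvg_lim => //; apply: cvg_near_cst.
by exists j.+1 => // N /= jN; rewrite /P_le_N; exact: h.
Qed.

Lemma integral_partial_sum (P : probability R R) (s : R) j :
  \int[P]_(y in `]0%R, s[) (S j y)%:E =
  \sum_(i < j.+1) \int[P]_(y in `]0%R, s[) (q i y)%:E.
Proof.
under eq_integral do rewrite -sumEFin.
rewrite ge0_integral_sum//.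
- by move=> i; exact/measurable_EFinP/measurable_funTS.
- by move=> i y; rewrite /= in_itv/= => /andP[y0 _]; rewrite lee_fin q_ge0.
Qed.

Lemma P_eq_of_kernel :
  (forall s : R, (0 < s)%R -> mu s [set 0%R] = (q 0 s)%:E) ->
  (forall (s : R) j, (0 < s)%R ->
     \int[mu s]_(y in `]0%R, s[) (q j y)%:E = (q j.+1 s)%:E) ->
  forall (t : R) j, (0 < t)%R -> P_eq mu t j = (q j t)%:E.
Proof.
move=> k0 kS.
(* The start s is decoupled from the threshold t: a step lowers s, N and j but leaves t fixed. *)
have SE (t : R) j : forall N (s : R), (j < N)%N -> (0 < s <= t)%R ->
    pathE mu N (cnt_le t j) s = (S j s)%:E.
  elim: j => [|j IH] [//|N] s jN st.
    by rewrite pathE_cnt_le_zero// k0 ?(andP st).1// /S big_ord1.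
  rewrite (pathE_cnt_le_sum st); last by move=> y; exact: IH.
  rewrite k0 ?(andP st).1// integral_partial_sum.
  under eq_bigr do rewrite kS ?(andP st).1//.
  by rewrite sumEFin -EFinD /S [in RHS]big_ord_recl.
have PE (t : R) j : (0 < t)%R -> P_le mu t j = (S j t)%:E.
  by move=> t0; apply: P_le_cst => N jN; apply: SE => //; rewrite t0 lexx.
move=> t [|j] t0; rewrite /P_eq !PE//; first by rewrite /S big_ord1.
by rewrite -EFinB /S big_ord_recr/= addrAC subrr add0r.
Qed.

Lemma kernel_of_P_eq :
  (forall (t : R) j, (0 < t)%R -> P_eq mu t j = (q j t)%:E) ->
  (forall s : R, (0 < s)%R -> mu s [set 0%R] = (q 0 s)%:E) /\
  (forall (s : R) j, (0 < s)%R ->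
     \int[mu s]_(y in `]0%R, s[) (q j y)%:E = (q j.+1 s)%:E).
Proof.
move=> Pq.
have PE (t : R) j : (0 < t)%R -> P_le mu t j = (S j t)%:E.
  move=> t0; elim: j => [|j IH]; first by rewrite /S big_ord1 -Pq.
  have := Pq t j.+1 t0; rewrite /P_eq IH.
  case: (P_le mu t j.+1) => [r| |]//; rewrite -EFinB => -[] rE.
  by congr EFin; rewrite [in RHS]/S big_ord_recr/= -rE addrC subrK.
have k0 (s : R) : (0 < s)%R -> mu s [set 0%R] = (q 0 s)%:E.
  move=> s0; have := PE s 0%N s0; rewrite (@P_le_cst _ _ (mu s [set 0%R])).
    by rewrite /S big_ord1.
  by case=> // N _; rewrite pathE_cnt_le_zero// s0 lexx.
have SE j : forall (t : R) N (s : R), (j < N)%N -> (0 < s <= t)%R ->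
    pathE mu N (cnt_le t j) s = (S j s)%:E.
  elim: j => [|j IH] t [//|N] s jN st.
    by rewrite pathE_cnt_le_zero// k0 ?(andP st).1// /S big_ord1.
  (* The hypothesis concerns only chains whose start equals the threshold. The right-hand side here
     depends on neither threshold nor horizon, so it can be evaluated at threshold s, where [PE]
     gives the limit. *)
  have step t' N' : (j < N')%N -> (s <= t')%R -> pathE mu N'.+1 (cnt_le t' j.+1) s =
      mu s [set 0%R] + \int[mu s]_(y in `]0%R, s[) (S j y)%:E.
    move=> jN' st'; apply: pathE_cnt_le_sum; first by rewrite (andP st).1.
    by move=> y; exact: IH.
  rewrite step ?(andP st).2// -PE ?(andP st).1//; apply/esym/P_le_cst.
  by case=> // N' jN'; exact: step.
split=> // s j s0.
have sums k : \sum_(i < k.+1) \int[mu s]_(y in `]0%R, s[) (q i y)%:E =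
    (\sum_(i < k.+1) q i.+1 s)%:E.
  have ss : (0 < s <= s)%R by rewrite s0 lexx.
  have := SE k.+1 s k.+2 s (ltnSn _) ss.
  rewrite (pathE_cnt_le_sum ss); last by move=> y; exact: SE.
  rewrite k0// integral_partial_sum /S [in RHS]big_ord_recl/= EFinD.
  exact: adde_EFinI.
(* The equation for the partial sums up to j, minus the single equations already known below j,
   leaves the one for j. *)
elim/ltn_ind: j => j IH; have := sums j.
rewrite !big_ord_recr/= EFinD (eq_bigr (fun i : 'I_j => (q i.+1 s)%:E)).
  by rewrite sumEFin; exact: adde_EFinI.
by move=> i _; exact: IH.
Qed.

End partial_sums.
End paths.

(** * The kernel *)

Section density_measure.
Local Open Scope ereal_scope.
Context d (T : measurableType d) (R : realType).
Variables (m : {measure set T -> \bar R}) (f : T -> R).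
Hypotheses (f0 : forall x, (0 <= f x)%R) (mf : measurable_fun [set: T] f).

Definition mdensity of (forall x, (0 <= f x)%R) & measurable_fun [set: T] f :=
  fun A : set T => \int[m]_(x in A) (f x)%:E.

Local Notation nu := (mdensity f0 mf).

Let mdensity0 : nu set0 = 0.
Proof. by rewrite /mdensity integral_set0. Qed.

Let mdensity_ge0 A : 0 <= nu A.
Proof. by apply: integral_ge0 => x _; rewrite lee_fin. Qed.

Let mdensity_sigma_additive : semi_sigma_additive nu.
Proof.
move=> /= F mF tF mUF; rewrite /mdensity; apply: cvg_toP.
  apply: ereal_nondecreasing_is_cvgn => i j ij.
  by apply: lee_sum_nneg_natr => // k _ _; exact: mdensity_ge0.
rewrite ge0_integral_bigcup//=.
- by apply: measurable_funTS; exact/measurable_EFinP.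
- by move=> x _; rewrite lee_fin.
Qed.

HB.instance Definition _ := isMeasure.Build _ _ _ nu
  mdensity0 mdensity_ge0 mdensity_sigma_additive.

Let mEf (D : set T) : measurable_fun D (EFin \o f).
Proof. by apply: measurable_funTS; exact/measurable_EFinP. Qed.

Import HBNNSimple.

Lemma integral_mdensity_indic (E : set T) : measurable E ->
  \int[nu]_x (\1_E x)%:E = \int[m]_x (\1_E x * f x)%:E.
Proof.
move=> mE; rewrite integral_indic//= setIT /mdensity integral_mkcond/=.
apply: eq_integral => x _; rewrite patchE indicE.
by case: ifP; rewrite ?mul1r ?mul0r.
Qed.

Lemma integral_mdensity_nnsfun (g : {nnsfun T >-> R}) :
  \int[nu]_x (g x)%:E = \int[m]_x (g x * f x)%:E.
Proof.
under [LHS]eq_integral do rewrite fimfunE -fsumEFin//.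
rewrite [LHS]ge0_integral_fsum//; last 2 first.
  - by move=> r; exact/measurable_EFinP/measurableT_comp.
  - by move=> n x _; rewrite EFinM nnfun_muleindic_ge0.
under [RHS]eq_integral.
  move=> x _; rewrite fimfunE EFinM -fsumEFin// ge0_mule_fsuml; last first.
    by move=> r; rewrite EFinM nnfun_muleindic_ge0.
  over.
rewrite [RHS]ge0_integral_fsum//; last 2 first.
  - move=> r; apply: emeasurable_funM; last exact: mEf.
    exact/measurable_EFinP/measurableT_comp.
  - by move=> n x _; apply: mule_ge0; rewrite ?lee_fin// -lee_fin EFinM nnfun_muleindic_ge0.
apply: eq_fsbigr => r _.
have [r0|r0] := ltP r 0%R.
  have g0 : g @^-1` [set r] = set0.
    apply/seteqP; split => // x /= gr.
    have : (0 <= g x)%R by [].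
    by rewrite gr leNgt r0.
  by rewrite g0 !integral0_eq// => x _; rewrite indic0 mulr0 ?mul0e.
transitivity (\int[m]_x (r%:E * (\1_(g @^-1` [set r]) x * f x)%:E)).
  rewrite integralZl_indic_nnsfun//= integral_mdensity_indic// ge0_integralZl//.
  - apply/measurable_EFinP/measurable_funM; first exact: measurable_indic.
    exact: mf.
  - by move=> x _; rewrite lee_fin mulr_ge0.
by apply: eq_integral => x _; rewrite -!EFinM mulrA.
Qed.

(** Monotone convergence on both sides along simple functions increasing to [h]. *)
Lemma ge0_integral_mdensity (h : T -> \bar R) : measurable_fun setT h ->
  (forall x, 0 <= h x) -> \int[nu]_x h x = \int[m]_x (h x * (f x)%:E).
Proof.
move=> mh h0; pose h_ := nnsfun_approx measurableT mh.
transitivity (limn (fun n => \int[nu]_x (h_ n x)%:E)).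
  rewrite -monotone_convergence//=.
  - apply: eq_integral => x _; apply/esym/cvg_lim => //=.
    exact: cvg_nnsfun_approx.
  - by move=> n; exact/measurable_EFinP/measurable_funTS.
  - by move=> n ? _; rewrite lee_fin.
  - by move=> ? _ ? ? mn; rewrite lee_fin; exact/lefP/nd_nnsfun_approx.
transitivity (limn (fun n => \int[m]_x (h_ n x * f x)%:E)).
  by apply: congr_lim; apply/funext => n; exact: integral_mdensity_nnsfun.
rewrite -monotone_convergence//=.
- apply: eq_integral => x _; apply/cvg_lim => //=.
  under eq_fun do rewrite EFinM.
  by apply: cvgeZr => //; exact: cvg_nnsfun_approx.
- move=> n; apply/measurable_EFinP/measurable_funM; last exact: mf.
  exact/measurable_funTS.
- by move=> n ? _; rewrite lee_fin mulr_ge0.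
- move=> x _ i j ij; rewrite lee_fin ler_wpM2r//; exact/lefP/nd_nnsfun_approx.
Qed.

Lemma ge0_integral_mdensity_in (D : set T) (h : T -> \bar R) : measurable D ->
  measurable_fun D h -> (forall x, D x -> 0 <= h x) ->
  \int[nu]_(x in D) h x = \int[m]_(x in D) (h x * (f x)%:E).
Proof.
move=> mD mh h0; rewrite [LHS]integral_mkcond [RHS]integral_mkcond.
rewrite [LHS](@ge0_integral_mdensity (h \_ D)).
- by apply: eq_integral => x _; rewrite !patchE; case: ifP; rewrite ?mul0e.
- by apply/(measurable_restrictT _ mD).
- by move=> x; rewrite patchE; case: ifP => // /[!inE]; exact: h0.
Qed.

End density_measure.

Section kernel.
Variable R : realType.
Notation leb := (@lebesgue_measure R).
Notation TR := (measurableTypeR R).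

(* Lebesgue measure lives on [measurableTypeR R], which has the Borel sets of
   [R] but another display; kernels are transported to [R] by the identity. *)
Definition idTR : TR -> R := idfun.

Lemma measurable_idTR : measurable_fun setT idTR.
Proof. exact: (@measurable_id _ TR setT). Qed.

HB.instance Definition _ := @isMeasurableFun.Build _ _ _ _ idTR measurable_idTR.

(* [dens] and [atom] describe the law of max (t U - X, 0) for independent U
   uniform on [0, 1] and X standard exponential. *)
Definition dens (t x : R) : R :=
  if (0 < x) && (x < t) then (1 - expR (x - t)) / t else 0.

Definition atom (t : R) : R := if 0 < t then qfun 0 t else 1.

Lemma dens_ge0 t x : 0 <= dens t x.
Proof.
rewrite /dens; case: ifP => // /andP[x0 xt].
rewrite divr_ge0 ?(ltW (lt_trans x0 xt))// subr_ge0 -[leRHS]expR0 ler_expR.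
by rewrite subr_le0 ltW.
Qed.

Lemma atom_ge0 t : 0 <= atom t.
Proof. by rewrite /atom; case: ifP => // t0; rewrite qfun_ge0// ltW. Qed.

Lemma measurable_dens2 : measurable_fun setT (fun tx : R * TR => dens tx.1 tx.2).
Proof.
have m1 : measurable_fun setT (fun tx : R * TR => tx.1) by exact: measurable_fst.
have m2 : measurable_fun setT (fun tx : R * TR => idTR tx.2).
  by apply: (measurableT_comp measurable_idTR); exact: measurable_snd.
(* for t > 0, t^-1 = expR (- ln t) *)
rewrite (_ : (fun _ => _) = fun tx : R * TR => if (0 < idTR tx.2) && (idTR tx.2 < tx.1)
    then (1 - expR (idTR tx.2 - tx.1)) * expR (- ln tx.1) else 0).
  apply: measurable_fun_ifT => //.
    by apply: measurable_and; exact: measurable_fun_ltr.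
  apply: measurable_funM.
    apply: measurable_funB => //; apply: measurableT_comp => //.
    exact: measurable_funB.
  apply: measurableT_comp => //; apply: measurableT_comp => //.
  exact: measurableT_comp.
apply/funext => -[t x]; rewrite /dens /=; case: ifP => // /andP[x0 xt].
by rewrite expRN lnK// posrE (lt_trans x0).
Qed.

Lemma measurable_dens t : measurable_fun setT (dens t : TR -> R).
Proof.
have mp : measurable_fun setT (fun x : TR => (t, x)) by exact: measurable_fun_pair.
exact: (measurableT_comp measurable_dens2 mp).
Qed.

Definition kern (t : R) : set TR -> \bar R :=
  measure_add (mscale (NngNum (atom_ge0 t)) (dirac (0 : TR)))
              (mdensity leb (dens_ge0 t) (measurable_dens t)).

HB.instance Definition _ t := Measure.on (kern t).

Lemma kernE t (A : set TR) : kern t A =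
  ((atom t)%:E * \d_(0%R : TR) A + \int[leb]_(x in A) (dens t x)%:E)%E.
Proof. by rewrite /kern measure_addE. Qed.

(** Since [dens t] vanishes off (0, t) and endpoints are Lebesgue-null, the integral moves to
    [0, t], where the fundamental theorem of calculus applies. *)
Lemma integral_densE t (A : set TR) (h : R -> R) : measurable A ->
  0 < t -> `]0, t[ `<=` A -> continuous h ->
  (\int[leb]_(x in A) (h x * dens t x)%:E =
   t^-1%:E * \int[leb]_(x in `[0%R, t]) ((1 - expR (x - t)) * h x)%:E)%E.
Proof.
move=> mA t0 tA ch.
have cf : continuous (fun x : R => (1 - expR (x - t)) * h x).
  move=> x; apply: cvgM; last exact: ch.
  apply: cvgB; first exact: cvg_cst.
  apply: continuous_comp; last exact: continuous_expR.
  by apply: cvgB; [exact: cvg_id|exact: cvg_cst].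
rewrite -integralZl//; last first.
  apply: continuous_compact_integrable; first exact: segment_compact.
  exact: continuous_subspaceT.
rewrite [RHS]integral_itv_bndoo; last first.
  apply: measurable_funTS; apply/measurable_EFinP.
  by apply: measurable_funM => //; exact: continuous_measurable_fun.
rewrite integral_mkcond [RHS]integral_mkcond; apply: eq_integral => x _.
have memE : (x \in (`]0, t[%classic : set TR)) = (0 < x) && (x < t).
  by apply/idP/idP; rewrite inE/= in_itv/=.
rewrite !patchE memE /dens.
case: (boolP ((0 < x) && (x < t))) => xt.
  by rewrite mem_set; [congr EFin; ring|apply: tA; rewrite /= in_itv].
by case: ifP; rewrite // mulr0.
Qed.

(** The density has mass (t - 1 + e^{-t})/t and the atom q_0(t) = (1 - e^{-t})/t. The set [A] is
    left general to cover both the whole line and [0, t). *)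
Lemma kern_total t (A : set TR) : 0 < t -> measurable A -> `]0, t[ `<=` A -> A 0 ->
  kern t A = 1%E.
Proof.
move=> t0 mA tA A0; rewrite kernE diracE mem_set// mule1 /atom t0.
under eq_integral do rewrite -[dens _ _]mul1r.
have dF x : is_derive x (1 : R) (fun y : R => y - expR (y - t)) ((1 - expR (x - t)) * 1).
  by apply: is_derive_eq; rewrite /GRing.scale/=; ring.
have cf : continuous (fun x : R => (1 - expR (x - t)) * 1).
  move=> x; apply: cvgM; last exact: cvg_cst.
  apply: cvgB; first exact: cvg_cst.
  apply: continuous_comp; last exact: continuous_expR.
  by apply: cvgB; [exact: cvg_id|exact: cvg_cst].
rewrite (@integral_densE t A (cst 1))//; last by move=> x; exact: cvg_cst.
rewrite (integral_is_derive t0 cf dF) subrr expR0 sub0r add0r opprK.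
rewrite -EFinM -EFinD; congr EFin.
apply: (mulfI (lt0r_neq0 t0)); rewrite mulrDr qfun0E// mulrA divff ?lt0r_neq0//.
by ring.
Qed.

Lemma kern_setT t : kern t setT = 1%E.
Proof.
have [t0|t0] := ltP 0 t; first exact: kern_total.
(* For t <= 0 the default values make the kernel the unit mass at 0. *)
rewrite kernE diracE mem_set// mule1 /atom ltNge t0/= integral0_eq ?adde0// => x _.
rewrite /dens; case: ifP => // /andP[x0 xt].
by have := lt_le_trans (lt_trans x0 xt) t0; rewrite ltxx.
Qed.

HB.instance Definition _ t :=
  @Measure_isProbability.Build _ _ R (kern t) (kern_setT t).

Definition rec_kernel (t : R) : probability R R :=
  distribution (kern t : probability TR R) idTR.

Lemma rec_kernelE t (A : set R) : rec_kernel t A = kern t A.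
Proof. by []. Qed.


Lemma rec_kernel_set0 t : rec_kernel t [set 0] = (atom t)%:E.
Proof.
by rewrite rec_kernelE kernE diracE mem_set// mule1 integral_set1 adde0.
Qed.

Lemma rec_kernel_markov : markov_kernel0 rec_kernel.
Proof.
move=> A mA; apply: measurable_funTS.
under eq_fun do rewrite rec_kernelE kernE.
apply: emeasurable_funD.
  apply: emeasurable_funM => //; apply/measurable_EFinP.
  apply: measurable_fun_ifT => //; first exact: measurable_fun_ltr.
  by apply: continuous_measurable_fun; exact: continuous_qfun.
(* With the indicator of [A] inside the integrand, the density part is a section integral of a
   jointly measurable function, measurable in t by Tonelli. *)
pose F (tx : R * TR) := (dens tx.1 tx.2 * \1_A tx.2)%:E.
have mF : measurable_fun setT F.
  apply/measurable_EFinP; apply: measurable_funM; first exact: measurable_dens2.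
  by apply: measurableT_comp => //; exact: measurable_indic.
have F0 tx : (0 <= F tx)%E by rewrite lee_fin mulr_ge0// dens_ge0.
have := measurable_fun_fubini_tonelli_F (m2 := leb) F mF F0.
congr (measurable_fun _ _); apply/funext => t; rewrite /fubini_F.
rewrite [RHS]integral_mkcond; apply: eq_integral => x _.
by rewrite /F patchE indicE/=; case: ifP; rewrite ?mulr1 ?mulr0.
Qed.

(** The atom sits at 0, outside (0, t), so only the density contributes and [qfun_kernel] evaluates
    it. *)
Lemma rec_kernel_qfun t j : 0 < t ->
  (\int[rec_kernel t]_(y in `]0%R, t[) (qfun j y)%:E = (qfun j.+1 t)%:E)%E.
Proof.
move=> t0.
have mq D : measurable_fun D (EFin \o qfun (R := R) j).
  apply: measurable_funTS; apply/measurable_EFinP.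
  by apply: continuous_measurable_fun; exact: continuous_qfun.
have q0 x : `]0, t[%classic x -> (0 <= (qfun j x)%:E)%E.
  by rewrite /= in_itv/= => /andP[x0 _]; rewrite lee_fin qfun_ge0// ltW.
have mI : measurable (idTR @^-1` `]0, t[) by exact: measurable_itv.
rewrite /rec_kernel /distribution ge0_integral_pushforward//; last first.
  by move=> x; rewrite inE; exact: q0.
rewrite /kern ge0_integral_measure_add//; last exact: mq.
rewrite ge0_integral_mscale//; last exact: mq.
rewrite integral_dirac//; last exact: mq.
rewrite diracE memNset ?mul0e ?mule0 ?add0e; last by rewrite /= in_itv/= ltxx.
rewrite ge0_integral_mdensity_in//; last exact: mq.
under eq_integral do rewrite -EFinM.
rewrite integral_densE//; last exact: continuous_qfun.
by rewrite qfun_kernel// -EFinM mulKf// gt_eqF.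
Qed.

End kernel.

(** * Uniqueness *)

Section uniqueness.
Variable R : realType.

(** The constraints on [mu t] at one fixed t; uniqueness is proved separately for each t. *)
Definition qfun_balanced (P : probability R R) (t : R) :=
  [/\ P `[0, t[%classic = 1%E, P [set 0] = (qfun 0 t)%:E &
   forall j, (\int[P]_(y in `]0%R, t[) (qfun j y)%:E = (qfun j.+1 t)%:E)%E].

(** The integral equations are weighted by (m+1)^j and summed; the result depends on t and m but no
    longer on [P]. *)
Lemma integral_qgen (P : probability R R) (t : R) m : qfun_balanced P t ->
  (\int[P]_(y in `]0%R, t[) (qgen m y)%:E =
   \sum_(j <oo) (m.+1%:R ^+ j * qfun j.+1 t)%:E)%E.
Proof.
move=> [_ _ Pq].
have gt0 y : `]0, t[%classic y -> 0 <= y by rewrite /= in_itv/= => /andP[/ltW].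
have mq j : measurable_fun `]0, t[ (EFin \o qfun (R := R) j).
  apply: measurable_funTS; apply/measurable_EFinP.
  by apply: continuous_measurable_fun; exact: continuous_qfun.
rewrite (eq_integral (fun y => \sum_(j <oo) (m.+1%:R ^+ j * qfun j y)%:E)%E); last first.
  by move=> y /[!inE] /gt0 y0; rewrite qfun_generating.
rewrite integral_nneseries//.
- apply: eq_eseriesr => j _; under eq_integral do rewrite EFinM.
  rewrite ge0_integralZl ?Pq//.
  + exact: mq.
  + by move=> y /gt0 y0; rewrite lee_fin qfun_ge0.
- move=> j; apply/measurable_EFinP; apply: measurable_funM => //.
  by apply/measurable_EFinP; exact: mq.
- by move=> j y /gt0 y0; rewrite lee_fin mulr_ge0 ?qfun_ge0// exprn_ge0.
Qed.

Lemma integrable_expr (P : probability R R) (t : R) n :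
  P.-integrable `]0%R, t[ (fun x => (x ^+ n)%:E).
Proof.
apply: (@integrableS _ _ _ _ `[0%R, t]) => //; first exact: subset_itv_oo_cc.
by apply: continuous_integrable => x; exact: exprn_continuous.
Qed.

Lemma integral_expr (P : probability R R) (t : R) m : qfun_balanced P t ->
  (\int[P]_(x in `]0%R, t[) (x ^+ m)%:E = ((m.+1)`!%:R)%:E *
   (\sum_(j <oo) (m.+1%:R ^+ j * qfun j.+1 t)%:E -
    \sum_(n < m) ('C(m, n)%:R / (n.+1)`!%:R)%:E * \int[P]_(x in `]0%R, t[) (x ^+ n)%:E))%E.
Proof.
move=> Pq; have iX n := integrable_expr P t n.
have iS k : P.-integrable `]0%R, t[ (fun x =>
    \sum_(n < k) (('C(m, n)%:R / (n.+1)`!%:R)%:E * (x ^+ n)%:E)%E).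
  by apply: integrable_sum => // n _; exact: integrableZl.
have qS x k : \sum_(n < k) (('C(m, n)%:R / (n.+1)`!%:R)%:E * (x ^+ n)%:E)%E =
    (\sum_(n < k) 'C(m, n)%:R / (n.+1)`!%:R * x ^+ n)%:E.
  by rewrite -sumEFin; apply: eq_bigr => n _; rewrite EFinM.
rewrite -(integral_qgen _ Pq).
rewrite (eq_integral (fun x => ((m.+1)`!%:R)%:E *
  ((qgen m x)%:E - \sum_(n < m) (('C(m, n)%:R / (n.+1)`!%:R)%:E * (x ^+ n)%:E)))%E).
  have iq : P.-integrable `]0%R, t[ (fun x => (qgen m x)%:E).
    by apply: eq_integrable (iS m.+1) => // x _; rewrite qS.
  have iSm := iS m.
  rewrite integralZl//; last by apply: integrableB.
  congr (_ * _)%E; rewrite integralB//.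
  congr (_ - _)%E; rewrite integral_sum//; last by move=> n; exact: integrableZl.
  by apply: eq_bigr => n _; rewrite integralZl.
by move=> x _; rewrite qS -EFinB -EFinM -qgen_moment.
Qed.

(** The endpoint t is null. The atom at 0 matters only for n = 0, where 0^0 = 1. *)
Lemma integral_expr_cc (P : probability R R) (t : R) n : 0 < t ->
  P `[0, t[%classic = 1%E ->
  (\int[P]_(x in `[0%R, t]) (x ^+ n)%:E =
   (0 ^+ n)%:E * P [set 0%R] + \int[P]_(x in `]0%R, t[) (x ^+ n)%:E)%E.
Proof.
move=> t0 Pt.
have mX D : measurable_fun D (fun x : R => (x ^+ n)%:E).
  apply: measurable_funTS; apply/measurable_EFinP.
  by apply: continuous_measurable_fun => x; exact: exprn_continuous.
have X0 (x : R) : 0 <= x -> (0 <= (x ^+ n)%:E)%E by move=> ?; rewrite lee_fin exprn_ge0.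
rewrite (@ge0_negligible_integral _ _ _ _ _ (~` `[0, t[%classic)) //; last 3 first.
- exact: measurableC.
- by move=> x; rewrite /= in_itv/= => /andP[x0 _]; exact: X0.
- exact: probability_compl0.
rewrite setDE setCK (_ : _ `&` _ = [set 0] `|` `]0, t[%classic); last first.
  rewrite setU1itv//; apply/setIidPr; exact: subset_itv_co_cc.
rewrite ge0_integral_setU//.
- congr (_ + _)%E; rewrite (eq_integral (cst (0 ^+ n)%:E)) ?integral_cst//.
  by move=> x; rewrite inE => ->.
- move=> x [->|]; first exact: X0.
  by rewrite /= in_itv/= => /andP[x0 _]; apply/X0/ltW.
- by apply/eqP/seteqP; split => // x [/= ->]; rewrite in_itv/= ltxx.
Qed.

Lemma qfun_balanced_unique (P1 P2 : probability R R) (t : R) (A : set R) :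
  0 < t -> qfun_balanced P1 t -> qfun_balanced P2 t -> measurable A -> P1 A = P2 A.
Proof.
move=> t0 b1 b2.
have full (P : probability R R) : qfun_balanced P t -> P `[0, t]%classic = 1%E.
  case=> Pt _ _; apply/eqP; rewrite eq_le probability_le1//= -Pt.
  by apply: le_measure; rewrite ?inE//; exact: subset_itv_co_cc.
apply: (eq_moments_measure t0 (full _ b1) (full _ b2)) => n.
case: (b1) (b2) => [s1 z1 _] [s2 z2 _].
rewrite !integral_expr_cc// z1 z2; congr (_ + _)%E.
(* The recursion expresses the n-th moment through strictly lower ones and a term common to both
   measures. *)
elim/ltn_ind: n => n IH; rewrite (integral_expr _ b1) (integral_expr _ b2).
congr (_ * (_ - _))%E; apply: eq_bigr => i _.
by rewrite IH.
Qed.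

End uniqueness.

(* Existence and uniqueness (on the state space [0,+oo)) of the kernel. *)
Theorem theorem3 (R : realType) :
  (exists mu : R -> probability R R, thm3_property mu) /\
  (forall mu1 mu2 : R -> probability R R,
     thm3_property mu1 -> thm3_property mu2 ->
     forall t : R, 0 <= t -> forall A : set R, measurable A -> mu1 t A = mu2 t A).
Proof.
have q0 j (y : R) : 0 < y -> 0 <= qfun j y by move=> /ltW; exact: qfun_ge0.
have mq j : measurable_fun setT (qfun (R := R) j).
  by apply: continuous_measurable_fun; exact: continuous_qfun.
split.
  exists (@rec_kernel R).
  have r0 : rec_kernel (0 : R) [set 0] = 1%E by rewrite rec_kernel_set0 /atom ltxx.
  have rt (t : R) : 0 < t -> rec_kernel t `[0, t[%classic = 1%E.
    move=> t0; rewrite rec_kernelE kern_total//.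
    - by move=> x /=; rewrite !in_itv/= => /andP[/ltW -> ->].
    - by rewrite /= in_itv/= lexx.
  split=> // [|t t0 j]; first exact: rec_kernel_markov.
  rewrite q_E//; apply: (P_eq_of_kernel r0 rt q0 mq) => // s.
    by move=> s0; rewrite rec_kernel_set0 /atom s0.
  by move=> i; exact: rec_kernel_qfun.
move=> mu1 mu2 h1 h2 t; rewrite le_eqVlt => /predU1P[<-|t0] A mA.
  have [[_ z1 _ _] [_ z2 _ _]] := (h1, h2).
  rewrite (probability_concentrated _ _ z1)// (probability_concentrated _ _ z2)//.
  have [A0|A0] := pselect (A 0).
    by rewrite (_ : _ `&` _ = [set 0]) ?z1 ?z2//; apply/setIidPl => _ ->.
  by rewrite (_ : _ `&` _ = set0) ?measure0//; apply/seteqP; split => // x [/= ->].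
have bal (mu : R -> probability R R) : thm3_property mu -> qfun_balanced (mu t) t.
  case=> _ z s Pq.
  have Pq' (s' : R) j : 0 < s' -> P_eq mu s' j = (qfun j s')%:E.
    by move=> s0; rewrite Pq// q_E.
  have [k0 kS] := kernel_of_P_eq z s q0 mq Pq'.
  by split; [exact: s|exact: k0|move=> j; exact: kS].
exact: (qfun_balanced_unique t0 (bal _ h1) (bal _ h2)).
Qed.
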